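(* Let $(\Omega,\mathcal F,(\mathcal F_t)_{t\in\mathbb N_0})$ be a filtered measurable space, $\mathcal P$ a family of probability measures on $(\Omega,\mathcal F)$, and $Q$ a probability measure on $(\Omega,\mathcal F)$. Let $(\alpha_k)_{k\ge1}$ be a decreasing sequence in $(0,1)$ with $\alpha_k\downarrow0$, put $b_k:=\log(1/\alpha_k)$, and for each $k$ let $\tau_k$ be an $(\mathcal F_t)$-stopping time with values in $\mathbb N_0\cup\{\infty\}$ such that $\sup_{P\in\mathcal P}P(\tau_k<\infty)\le\alpha_k$. Assume the family is nested: $j\le k$ implies $\tau_j\le\tau_k$ pathwise on $\Omega$. Let $(w_k)_{k\ge1}$ be nonnegative weights, not all zero, with $\sum_{k=1}^\infty w_k\alpha_k\le1$, and define $$M_t:=\sum_{k=1}^\infty w_k\mathbf 1_{\{\tau_k\le t\}}\ (t\in\mathbb N_0),\qquad W(x):=\sum_{k:\,b_k\le x}w_k\ (x\ge0).$$ Assume that $W(x)\to\infty$ as $x\to\infty$ and that $\frac{\log W(x)}{x}\to\rho$ as $x\to\infty$ for some $\rho\in[0,1]$. Let $I\in(0,\infty)$ and suppose that $\tau_k/b_k\to1/I$ in $Q$-probability as $k\to\infty$. Then, in $Q$-probability as $t\to\infty$, $$\frac1t\log M_t\longrightarrow\rho I.$$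
   Context: $\mathbb N_0=\{0,1,2,\dots\}$. The process $M_t$ takes values in $[0,\infty]$, with the conventions $\log 0=-\infty$, $\log\infty=\infty$. Since $b_k\uparrow\infty$, $W(x)$ is a finite sum for each $x$. *)

(* Defs.v *)
From mathcomp Require Import all_boot all_order all_algebra.
From mathcomp Require Import all_classical all_reals all_analysis.

Set Implicit Arguments.
Unset Strict Implicit.
Unset Printing Implicit Defensive.

Import Order.TTheory GRing.Theory Num.Theory.
Import numFieldNormedType.Exports.

Local Open Scope classical_set_scope.
Local Open Scope ring_scope.

Definition is_filtration (d : measure_display) (T : measurableType d)
    (F : nat -> set (set T)) : Prop :=
  [/\ forall t, sigma_algebra setT (F t),
      forall t, F t `<=` measurable &
      forall s t, (s <= t)%N -> F s `<=` F t].

(* Random times take values in [option nat], where [None] stands for oo. *)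
Definition time_le (a b : option nat) : bool :=
  match a, b with
  | _, None => true
  | None, Some _ => false
  | Some s, Some t => (s <= t)%N
  end.

Definition time_ereal (R : realType) (a : option nat) : \bar R :=
  if a is Some s then (s%:R)%:E else +oo%E.

Definition stopping_time (d : measure_display) (T : measurableType d)
    (F : nat -> set (set T)) (tau : T -> option nat) : Prop :=
  forall t : nat, F t [set x | time_le (tau x) (Some t)].

(* Since |+oo - l| = |-oo - l| = +oo, infinite values of [X n] always count
   as deviations from the limit. *)
Definition cvg_in_probability (d : measure_display) (T : measurableType d)
    (R : realType) (Q : probability T R) (X : nat -> T -> \bar R) (l : R)
    : Prop :=
  forall e : R, 0 < e ->
    (Q [set x | e%:E < `|X n x - l%:E|]%E) @[n --> \oo] --> 0%E.

(* Sequences written (a_k)_{k >= 1} are functions on [nat] whose value at 0 is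
   never used: all series start at k = 1. *)

Definition log_inv (R : realType) (alpha : nat -> R) (k : nat) : R :=
  ln (1 / alpha k).

Definition mixture (T : Type) (R : realType) (w : nat -> R)
    (tau : nat -> T -> option nat) (t : nat) (x : T) : \bar R :=
  (\sum_(1 <= k <oo)
     (w k * \1_[set y | time_le (tau k y) (Some t)] x)%:E)%E.

(* An [\bar R]-valued series, which has finitely many terms as soon as
   [b k] tends to +oo. *)
Definition cum_weight (R : realType) (w b : nat -> R) (x : R) : \bar R :=
  (\sum_(1 <= k <oo | (b k <= x)%R) (w k)%:E)%E.

(* Main.v *)
(** Since the stopping times are nested, M_t is at least the sum of the w_j with
    j <= k as soon as tau_k <= t, and at most the sum of the w_j with j < k as
    long as tau_k > t. Choose k with b_k <= y < b_(k+1), so that W(y) is the sum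
    of w_1, ..., w_k. For y = t I (1 + delta), the event tau_(k+1) > t gives
    M_t <= W(y); for y = t I (1 - delta), the event tau_k <= t gives
    M_t >= W(y). The complements force tau_(k+1) / b_(k+1), resp. tau_k / b_k,
    to deviate from 1 / I by more than delta / (2 I), so their Q-probabilities
    vanish, while (1/t) log W(t I (1 +- delta)) tends to rho I (1 +- delta). *)

Require Import Defs.
From mathcomp Require Import all_boot all_order all_algebra.
From mathcomp Require Import all_classical all_reals all_analysis.
From mathcomp Require Import measurable_realfun.
From mathcomp Require Import ring lra.

Set Implicit Arguments.
Unset Strict Implicit.
Unset Printing Implicit Defensive.

Import Order.TTheory GRing.Theory Num.Theory.
Import numFieldNormedType.Exports.
Local Open Scope classical_set_scope.
Local Open Scope ring_scope.

(** * Monotonicity and measurability of the extended logarithm *)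

Section lne_extra.
Context {R : realType}.
Implicit Types x y : \bar R.

Lemma le_lne : {homo @lne R : x y / (x <= y)%E}.
Proof.
move=> x y xy; have [x0|x0] := leP x 0%E; first by rewrite le0_lneNy// leNye.
by rewrite lee_lne// in_itv/= leey andbT ?(ltW x0)// (le_trans (ltW x0)).
Qed.

(** For [x <= 0] both sides are false, as [lne x] is -oo and [expR r] is nonnegative. Hence
    preimages of open upper rays under [lne] are again such rays, which yields its measurability. *)
Lemma lt_lneRL (r : R) x : (r%:E < lne x)%E = ((expR r)%:E < x)%E.
Proof.
have [x0|x0] := leP x 0%E.
  rewrite le0_lneNy// ltNge leNye/=; apply/esym/negbTE; rewrite -leNgt.
  by rewrite (le_trans x0)// lee_fin expR_ge0.
by rewrite -[r%:E]expeRK lte_lne//= in_itv/= leey andbT ?(ltW x0)// lee_fin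
  expR_ge0.
Qed.

Lemma measurable_lne : measurable_fun [set: \bar R] (@lne R).
Proof.
move=> mD; apply: (measurability _ (ErealGenOInfty.measurableE R)) => //.
move=> _ [_ [r ->] <-]; rewrite setTI.
rewrite [X in measurable X](_ : _ = `](expR r)%:E, +oo[%classic).
  exact: emeasurable_itv.
by apply/seteqP; split=> x /=; rewrite !in_itv/= !andbT lt_lneRL.
Qed.

End lne_extra.

(** * The levels b_k and the index of the last level below a given y *)

Section log_inv_levels.
Context {R : realType} (alpha : nat -> R).
Hypothesis alpha01 : forall k, (1 <= k)%N -> 0 < alpha k < 1.
Hypothesis alpha_decr :
  forall j k, (1 <= j)%N -> (j <= k)%N -> alpha k <= alpha j.
Hypothesis alpha_lim : alpha k @[k --> \oo] --> (0 : R).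

Lemma log_inv_gt0 k : (1 <= k)%N -> 0 < log_inv alpha k.
Proof.
by move=> /alpha01 /andP[a0 a1]; rewrite /log_inv ln_gt0// div1r invf_gt1.
Qed.

Lemma log_inv_homo j k : (1 <= j)%N -> (j <= k)%N ->
  log_inv alpha j <= log_inv alpha k.
Proof.
move=> j1 jk; have /andP[aj0 _] := alpha01 j1.
have /andP[ak0 _] := alpha01 (leq_trans j1 jk).
rewrite /log_inv !div1r ler_ln ?posrE ?invr_gt0//.
by rewrite lef_pV2 ?posrE// alpha_decr.
Qed.

Lemma log_inv_unbounded (y : R) : exists2 k, (1 <= k)%N & y < log_inv alpha k.
Proof.
have [N _ aN] := cvgr_lt _ alpha_lim _ (expR_gt0 (- y)).
(* [N.+1] instead of [N] guarantees an index at least 1; there alpha is below exp(-y). *)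
have /andP[a0 _] := alpha01 (isT : (1 <= N.+1)%N).
exists N.+1 => //; rewrite /log_inv div1r lnV ?posrE// ltrNr.
by rewrite -(expRK (- y)) ltr_ln ?posrE ?expR_gt0//; exact/aN/leqnSn.
Qed.

Lemma log_inv_level : exists2 k : R -> nat, k y @[y --> +oo] --> \oo &
  \forall y \near +oo, [/\ (1 <= k y)%N, log_inv alpha (k y) <= y &
    y < log_inv alpha (k y).+1].
Proof.
have /choice[k kP] : forall y, exists k, log_inv alpha 1 <= y ->
    [/\ (1 <= k)%N, log_inv alpha k <= y & y < log_inv alpha k.+1].
  move=> y; have ex : exists k, (1 <= k)%N && (y < log_inv alpha k).
    by have [k k1 yk] := log_inv_unbounded y; exists k; rewrite k1.
  case: (ex_minnP ex) => -[//|k] /= yk kmin; exists k => b1y.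
  have k1 : (1 <= k)%N.
    by case: k yk {kmin} => // /(le_lt_trans b1y); rewrite ltxx.
  split=> //; rewrite leNgt; apply/negP => ylt.
  by have := kmin k; rewrite k1 ylt => /(_ isT); rewrite ltnn.
exists k; last first.
  by near=> y; apply: kP; near: y; apply: nbhs_pinfty_ge; exact: num_real.
apply/cvgnyPge => K; near=> y.
have [|k1 _ yk] := kP y.
  by near: y; apply: nbhs_pinfty_ge; exact: num_real.
(* If [k y < K], then y < b_(k y + 1) <= b_K, which fails for large y. *)
rewrite leqNgt; apply/negP => kK.
have : log_inv alpha K <= y by near: y; apply: nbhs_pinfty_ge; exact: num_real.
by rewrite leNgt (lt_le_trans yk)// log_inv_homo.
Unshelve. all: by end_near. Qed.

End log_inv_levels.

(** * Order and measurability of the random times *)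

Lemma time_le_trans (a b c : option nat) :
  time_le a b -> time_le b c -> time_le a c.
Proof. by case: a b c => [a|] [b|] [c|]//=; exact: leq_trans. Qed.

(** The value space is countable, so it suffices to treat singletons: {tau = n} is {tau <= n} minus
    the earlier events, and {tau = oo} is what the finite values leave over. *)
Lemma stopping_time_measurable_preimage d (T : measurableType d)
    (F : nat -> set (set T)) (tau : T -> option nat) (A : set (option nat)) :
  is_filtration F -> stopping_time F tau -> measurable (tau @^-1` A).
Proof.
move=> [_ Fm _] st.
have mle t : measurable [set x | time_le (tau x) (Some t)] by exact/Fm/st.
have mSome n : measurable (tau @^-1` [set Some n]).
  rewrite [X in measurable X](_ : _ = [set x | time_le (tau x) (Some n)] `\`
    \bigcup_(m in [set m | (m < n)%N]) [set x | time_le (tau x) (Some m)]).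
    by apply: measurableD => //; apply: bigcup_measurable => m _; exact: mle.
  apply/seteqP; split=> x /=.
    move=> tx; split=> /=; first by rewrite tx /=.
    by move=> [m /= mn]; rewrite tx /= leqNgt mn.
  case E : (tau x) => [s|]/= [// sn Hs]; congr Some; apply/eqP.
  rewrite eqn_leq sn leqNgt; apply/negP => sn'; apply: Hs; exists s => //=.
  by rewrite E /=.
have mNone : measurable (tau @^-1` [set None]).
  rewrite [X in measurable X](_ : _ = ~` \bigcup_n (tau @^-1` [set Some n])).
    by apply: measurableC; exact: bigcup_measurable.
  apply/seteqP; split=> x /=; first by move=> tx [n _ /=]; rewrite tx.
  by case E : (tau x) => [s|//] nos; case: nos; exists s.
have mA : measurable
    (\bigcup_(n in [set n | A (Some n)]) (tau @^-1` [set Some n])).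
  by apply: bigcup_measurable => n _; exact: mSome.
have [AN|AN] := pselect (A None).
  rewrite [X in measurable X](_ : _ = (tau @^-1` [set None]) `|`
    \bigcup_(n in [set n | A (Some n)]) (tau @^-1` [set Some n])).
    exact: measurableU.
  apply/seteqP; split=> x /=; last by case=> [->//|[n /= An ->]].
  by case E : (tau x) => [n|] An; [right; exists n|left].
rewrite [X in measurable X](_ : _ =
  \bigcup_(n in [set n | A (Some n)]) (tau @^-1` [set Some n]))//.
apply/seteqP; split=> x /=; last by case=> [n /= An ->].
by case E : (tau x) => [n|//] An; exists n.
Qed.

(** * Termwise comparison of M_t with W, and measurability of M_t *)

Section mixture.
Context {R : realType} {d} {T : measurableType d} (w : nat -> R).
Hypothesis w_ge0 : forall k, (1 <= k)%N -> 0 <= w k.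
Variable tau : nat -> T -> option nat.

Lemma mixtureE t x :
  mixture w tau t x =
  (\sum_(k <oo | (1 <= k)%N)
    (w k * \1_[set y | time_le (tau k y) (Some t)] x)%:E)%E.
Proof. exact: eseries_cond. Qed.

Lemma cum_weightE (b : nat -> R) y :
  cum_weight w b y =
  (\sum_(k <oo | (1 <= k)%N) (if (b k <= y)%R then (w k)%:E else 0))%E.
Proof. by rewrite /cum_weight eseries_cond eseries_mkcondl. Qed.

Lemma le_mixture_cum_weight (b : nat -> R) t x y :
    (forall k, (1 <= k)%N -> time_le (tau k x) (Some t) -> b k <= y) ->
  (mixture w tau t x <= cum_weight w b y)%E.
Proof.
move=> h; rewrite mixtureE cum_weightE; apply: lee_nneseries => k.
  by move=> _ k1; rewrite lee_fin mulr_ge0// w_ge0.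
move=> k1; rewrite indicE; case: (boolP (_ \in _)) => [|_]/=.
  by rewrite inE/= => /(h _ k1) ->; rewrite mulr1.
by rewrite mulr0; case: ifP => // _; rewrite lee_fin w_ge0.
Qed.

Lemma cum_weight_le_mixture (b : nat -> R) t x y :
    (forall k, (1 <= k)%N -> b k <= y -> time_le (tau k x) (Some t)) ->
  (cum_weight w b y <= mixture w tau t x)%E.
Proof.
move=> h; rewrite mixtureE cum_weightE; apply: lee_nneseries => k.
  by move=> _ k1; case: ifP => // _; rewrite lee_fin w_ge0.
move=> k1; case: ifP => [/(h _ k1) kt|_]; last first.
  by rewrite lee_fin mulr_ge0// w_ge0.
by rewrite indicE mem_set// mulr1.
Qed.

Lemma measurable_mixture t :
    (forall k, (1 <= k)%N -> measurable [set x | time_le (tau k x) (Some t)]) ->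
  measurable_fun setT (mixture w tau t).
Proof.
move=> mtau; rewrite (funext (mixtureE t)).
apply: (@ge0_emeasurable_sum _ _ _ _ _ (fun k => (1 <= k)%N)) => k.
  by move=> x _ k1; rewrite lee_fin mulr_ge0// w_ge0.
move=> k1; apply/measurable_EFinP/measurable_funM => //.
by apply: measurable_indic; exact: mtau.
Qed.

End mixture.

(** * Stopping too early or too late forces a deviation of tau/b from 1/I *)

Section time_deviation.
Context {R : realType}.
Variables (b I delta : R).
Hypotheses (b0 : 0 < b) (I0 : 0 < I) (delta01 : 0 < delta < 1).

(** Here s/b < 1/(I(1 + delta)), which lies delta/(I(1 + delta)) below 1/I; since delta < 1, this
    gap is at least delta/(2I). *)
Lemma early_deviation (s : option nat) (n : nat) : time_le s (Some n) ->
  n%:R * (I * (1 + delta)) < b ->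
  ((delta / (2 * I))%:E < `|time_ereal R s * (b^-1)%:E - (I^-1)%:E|)%E.
Proof.
case: s => [s|//]/= sn nb; have /andP[d0 d1] := delta01.
rewrite lte_fin distrC.
apply: lt_le_trans (ler_norm _).
have sb : s%:R / b < (I * (1 + delta))^-1.
  rewrite ltr_pdivrMr// mulrC ltr_pdivlMr ?mulr_gt0 ?addr_gt0//.
  apply: le_lt_trans nb; rewrite ler_wpM2r ?ler_nat//.
  by rewrite mulr_ge0 ?(ltW I0)// addr_ge0// ltW.
have : I^-1 - (I * (1 + delta))^-1 = delta / (I * (1 + delta)).
  by field; rewrite !gt_eqF ?addr_gt0.
have : delta / (2 * I) <= delta / (I * (1 + delta)).
  rewrite ler_pM2l// lef_pV2 ?posrE ?mulr_gt0 ?addr_gt0//.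
  by rewrite mulrC ler_pM2r//; lra.
lra.
Qed.

(** A finite s has s/b > 1/(I(1 - delta)), which exceeds 1/I by delta/(I(1 - delta)), at least
    delta/(2I). An infinite s deviates by +oo. *)
Lemma late_deviation (s : option nat) (n : nat) : ~~ time_le s (Some n) ->
  b <= n%:R * (I * (1 - delta)) ->
  ((delta / (2 * I))%:E < `|time_ereal R s * (b^-1)%:E - (I^-1)%:E|)%E.
Proof.
case: s => [s|_ _]/=; last first.
  by rewrite gt0_mulye ?lte_fin ?invr_gt0// addye// ltry.
rewrite -ltnNge => ns nb; have /andP[d0 d1] := delta01.
have e0 : 0 < 1 - delta by lra.
rewrite lte_fin.
apply: lt_le_trans (ler_norm _).
have sb : (I * (1 - delta))^-1 < s%:R / b.
  rewrite ltr_pdivlMr// mulrC ltr_pdivrMr ?mulr_gt0//.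
  by apply: le_lt_trans nb _; rewrite ltr_pM2r ?mulr_gt0// ltr_nat.
have : (I * (1 - delta))^-1 - I^-1 = delta / (I * (1 - delta)).
  by field; rewrite !gt_eqF.
have : delta / (2 * I) <= delta / (I * (1 - delta)).
  rewrite ler_pM2l// lef_pV2 ?posrE ?mulr_gt0//.
  by rewrite mulrC ler_pM2r//; lra.
lra.
Qed.

End time_deviation.

(** * Convergence in probability of the growth rate *)

Theorem theorem5p5 (R : realType) (d : measure_display) (Omega : measurableType d)
  (F : nat -> set (set Omega)) (PP : set (probability Omega R))
  (Q : probability Omega R)
  (alpha w : nat -> R) (tau : nat -> Omega -> option nat) (rho I : R)
  (hF : is_filtration F)
  (halpha01 : forall k : nat, (1 <= k)%N -> 0 < alpha k < 1)
  (halpha_decr : forall j k : nat, (1 <= j)%N -> (j <= k)%N -> alpha k <= alpha j)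
  (halpha_lim : alpha k @[k --> \oo] --> (0 : R))
  (htau_stop : forall k : nat, (1 <= k)%N -> stopping_time F (tau k))
  (htau_level : forall k : nat, (1 <= k)%N ->
     (ereal_sup [set (P : probability Omega R) [set x | tau k x <> None] | P in PP]
        <= (alpha k)%:E)%E)
  (htau_nested : forall j k : nat, (1 <= j)%N -> (j <= k)%N ->
     forall x : Omega, time_le (tau j x) (tau k x))
  (hw_ge0 : forall k : nat, (1 <= k)%N -> 0 <= w k)
  (hw_neq0 : exists2 k : nat, (1 <= k)%N & w k != 0)
  (hw_sum : (\sum_(1 <= k <oo) (w k * alpha k)%:E <= 1)%E)
  (hW_lim : cum_weight w (log_inv alpha) x @[x --> +oo] --> +oo%E)
  (hrho : 0 <= rho <= 1)
  (hW_rate : ((x^-1)%:E * lne (cum_weight w (log_inv alpha) x))%E @[x --> +oo]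
     --> rho%:E)
  (hI : 0 < I)
  (htau_cvg : cvg_in_probability Q
     (fun k x => time_ereal R (tau k x) * ((log_inv alpha k)^-1)%:E)%E I^-1) :
  cvg_in_probability Q
    (fun t x => ((t%:R^-1)%:E * lne (mixture w tau t x))%E) (rho * I).
Proof.
set b := log_inv alpha.
set dev := (X in cvg_in_probability Q X) in htau_cvg.
move=> e e0.
have /andP[rho0 rho1] := hrho.
(* The final error is at most I delta (1 + rho + delta) <= 3 I delta <= e, using rho <= 1 and delta
   <= 1. The cap 1/2 keeps 1 - delta positive. *)
pose delta := Num.min (1/2) (e / (3 * I)).
have delta0 : 0 < delta by rewrite lt_min !divr_gt0// mulr_gt0.
have delta_half : delta <= 1/2 by rewrite ge_min lexx.
have delta01 : 0 < delta < 1 by rewrite delta0/=; lra.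
have deltae : 3 * I * delta <= e.
  have : delta <= e / (3 * I) by rewrite ge_min lexx orbT.
  by rewrite ler_pdivlMr ?mulr_gt0// mulrC.
have b_gt0 := log_inv_gt0 halpha01.
have b_homo := log_inv_homo halpha01 halpha_decr.
have [k koo klevel] := log_inv_level halpha01 halpha_decr halpha_lim.
pose a1 := I * (1 + delta).
pose a2 := I * (1 - delta).
have a1_gt0 : 0 < a1 by apply: mulr_gt0 => //; lra.
have a2_gt0 : 0 < a2 by apply: mulr_gt0 => //; lra.
have scale_cvg (a : R) :
    0 < a -> (t%:R * a) @[t --> \oo] --> (+oo : set_system R).
  move=> a0; apply/cvgryPge => A; near=> t.
  rewrite -ler_pdivrMr//; near: t; exact: nbhs_infty_ger.
pose E t := [set x |
  (e%:E < `|(t%:R^-1)%:E * lne (mixture w tau t x) - (rho * I)%:E|)%E].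
pose D n := [set x | ((delta / (2 * I))%:E < `|dev n x - (I^-1)%:E|)%E].
have c0 : 0 < delta / (2 * I) by rewrite divr_gt0// mulr_gt0.
have QD : Q (D n) @[n --> \oo] --> 0%E by exact: htau_cvg.
have mtau n : (1 <= n)%N -> forall A, measurable (tau n @^-1` A).
  move=> n1 A.
  exact: (stopping_time_measurable_preimage _ hF (htau_stop _ n1)).
have mD n : (1 <= n)%N -> measurable (D n).
  move=> n1; exact: (mtau _ n1 [set s | ((delta / (2 * I))%:E <
    `|time_ereal R s * ((b n)^-1)%:E - (I^-1)%:E|)%E]).
have mE t : measurable (E t).
  have mM : measurable_fun setT
      (fun x => `|(t%:R^-1)%:E * lne (mixture w tau t x) - (rho * I)%:E|%E).
    apply: measurableT_comp => //; apply: emeasurable_funB => //.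
    apply: emeasurable_funM => //.
    apply: (measurableT_comp measurable_lne).
    apply: measurable_mixture => // n n1.
    exact: (mtau _ n1 [set s | time_le s (Some t)]).
  rewrite -[E t]setTI; exact: emeasurable_fun_o_infty.
(* [up t] is the first level strictly above t a1, [lo t] the last one not above t a2; both tend to
   infinity with t. *)
pose up t := (k (t%:R * a1)).+1.
pose lo t := k (t%:R * a2).
have kscale (a : R) : 0 < a -> k (t%:R * a) @[t --> \oo] --> \oo.
  by move=> a0; exact: cvg_comp (scale_cvg _ a0) koo.
have QDup : Q (D (up t)) @[t --> \oo] --> 0%E.
  apply: (@cvg_comp _ _ _ up (Q \o D) _ \oo _ _ QD); apply/cvgnyPge => K.
  by have /cvgnyPge/(_ K) := kscale _ a1_gt0; apply: filterS => t /leqW.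
have QDlo : Q (D (lo t)) @[t --> \oo] --> 0%E.
  exact: (@cvg_comp _ _ _ lo (Q \o D) _ \oo _ (kscale _ a2_gt0) QD).
have level (a : R) : 0 < a -> \forall t \near \oo, [/\ (1 <= k (t%:R * a)%R)%N,
    b (k (t%:R * a)) <= t%:R * a & t%:R * a < b (k (t%:R * a)).+1].
  by move=> a0; exact: (scale_cvg _ a0 _ klevel).
have rate (a : R) : 0 < a -> \forall t \near \oo,
    ((a * (rho - delta))%:E <= (t%:R^-1)%:E * lne (cum_weight w b (t%:R * a)%R)
      <= (a * (rho + delta))%:E)%E.
  move=> a0.
  have rlt : rho < rho + delta by rewrite ltrDl.
  have rgt : rho - delta < rho by rewrite ltrBlDr ltrDl.
  have := hW_rate _ (@nbhs_open_ereal_lt _ rho (fun=> rho + delta) rlt).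
  move=> /(scale_cvg _ a0 _) ub.
  have := hW_rate _ (@nbhs_open_ereal_gt _ rho (fun=> rho - delta) rgt).
  move=> /(scale_cvg _ a0 _) lb.
  near=> t.
  have t0 : 0 < t%:R :> R by rewrite ltr0n; near: t; exact: nbhs_infty_gt.
  (* This turns the bound on log W(x) / x at x = t a into one on log W(t a) / t, with an extra
     factor a. *)
  have -> : t%:R^-1 = a * (t%:R * a)^-1 by field; rewrite !gt_eqF.
  rewrite !EFinM -muleA !lee_pmul2l ?lte_fin//.
  by apply/andP; split; apply/ltW; near: t; [exact: lb|exact: ub].
(* For large t, [E t] is contained in the union of [D (up t)] and [D (lo t)], so the union bound
   applies. *)
apply: (@squeeze_cvge _ _ _ _ (fun=> 0%E) _
  (fun t => Q (D (up t)) + Q (D (lo t)))%E); last 2 first.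
  exact: cvg_cst.
  by rewrite -[X in _ --> X]adde0; apply: cvgeD.
near=> t; rewrite measure_ge0/=.
have t0 : 0 < t%:R :> R by rewrite ltr0n; near: t; exact: nbhs_infty_gt.
have [_ leup ltup] : [/\ (1 <= k (t%:R * a1)%R)%N,
    b (k (t%:R * a1)) <= t%:R * a1 & t%:R * a1 < b (up t)].
  by near: t; exact: level.
have [lo1 lelo ltlo] : [/\ (1 <= lo t)%N, b (lo t) <= t%:R * a2 &
    t%:R * a2 < b (lo t).+1] by near: t; exact: level.
apply: (@le_trans _ _ (Q (D (up t) `|` D (lo t)))); last first.
  by apply: measureU2; exact: mD.
apply: le_measure.
- exact/mem_set/mE.
- by apply/mem_set/measurableU; exact: mD.
move=> x Ex; apply: contrapT => /not_orP[nup nlo].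
have tau_up : ~~ time_le (tau (up t) x) (Some t).
  apply/negP => tt; apply: nup; apply: early_deviation tt _ => //.
  exact: b_gt0.
have tau_lo : time_le (tau (lo t) x) (Some t).
  apply: contrapT => /negP tt; apply: nlo; apply: late_deviation tt _ => //.
  exact: b_gt0.
have MW : (mixture w tau t x <= cum_weight w b (t%:R * a1)%R)%E.
  apply: le_mixture_cum_weight => // j j1 jt.
  (* A level b_j above t a1 has j >= [up t], so by nestedness tau_j <= t would give tau_(up t) <=
     t. *)
  rewrite leNgt; apply/negP => ltj; move/negP: tau_up; apply.
  apply: time_le_trans jt; apply: htau_nested => //; rewrite leqNgt; apply/negP.
  rewrite ltnS => jk; have := le_trans (b_homo _ _ j1 jk) leup.
  by rewrite leNgt ltj.
have WM : (cum_weight w b (t%:R * a2)%R <= mixture w tau t x)%E.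
  apply: cum_weight_le_mixture => // j j1 jt.
  have jlo : (j <= lo t)%N.
    rewrite leqNgt; apply/negP => /(b_homo (lo t).+1 _ isT).
    by move=> /(lt_le_trans ltlo); rewrite ltNge jt.
  exact: time_le_trans (htau_nested _ _ j1 jlo x) tau_lo.
have tV0 : (0 <= (t%:R^-1)%:E :> \bar R)%E by rewrite lee_fin invr_ge0 ltW.
have /andP[_ ub] : ((a1 * (rho - delta))%:E <= (t%:R^-1)%:E *
  lne (cum_weight w b (t%:R * a1)%R) <= (a1 * (rho + delta))%:E)%E.
  by near: t; exact: rate.
have /andP[lb _] : ((a2 * (rho - delta))%:E <= (t%:R^-1)%:E *
  lne (cum_weight w b (t%:R * a2)%R) <= (a2 * (rho + delta))%:E)%E.
  by near: t; exact: rate.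
have {}ub := le_trans (lee_wpmul2l tV0 (le_lne MW)) ub.
have {}lb := le_trans lb (lee_wpmul2l tV0 (le_lne WM)).
move: Ex; rewrite /E/= ltNge => /negP; apply.
(* [lra] treats these products as atoms, so each is bounded beforehand. *)
have rd0 : 0 <= I * delta * rho by rewrite !mulr_ge0// ltW.
have rd1 : I * delta * rho <= I * delta by rewrite ler_piMr// mulr_ge0// ltW.
have dd1 : I * delta * delta <= I * delta.
  by rewrite ler_piMr// ?mulr_ge0// ltW//; lra.
have dd0 : 0 <= I * delta * delta by rewrite !mulr_ge0// ltW.
(* The two finite bounds exclude the values +oo and -oo. *)
move: lb ub; rewrite /a1 /a2; case: (_ * lne _)%E => [r| |]//=.
rewrite !lee_fin ler_norml => lb ub; apply/andP; split; lra.
Unshelve. all: by end_near.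
Qed.
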